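(* Let $v$ be a positive integer, and consider integers $e$ with $0\le e\le\binom v2$; write $e'=\binom v2-e$. (1) If $q_0(v)>0$, then $S(v,e)\ge C(v,e)$ for all $0\le e\le m$ and $S(v,e)\le C(v,e)$ for all $m\le e\le\binom v2$; moreover $S(v,e)=C(v,e)$ if and only if $e$ or $e'$ lies in $\{0,1,2,3,m\}$, or $e$ or $e'$ equals $e_0$ and $(2v-3)^2-2(2k_0-1)^2\in\{-1,7\}$. (2) If $q_0(v)<0$, then $C(v,e)\le S(v,e)$ for $0\le e\le m-R_0$, $C(v,e)\ge S(v,e)$ for $m-R_0\le e\le m$, $C(v,e)\le S(v,e)$ for $m\le e\le m+R_0$, and $C(v,e)\ge S(v,e)$ for $m+R_0\le e\le\binom v2$; moreover $S(v,e)=C(v,e)$ if and only if $e$ or $e'$ lies in $\{0,1,2,3,m-R_0,m\}$. (3) If $q_0(v)=0$, then $S(v,e)\ge C(v,e)$ for all $0\le e\le m$ and $S(v,e)\le C(v,e)$ for all $m\le e\le\binom v2$; moreover $S(v,e)=C(v,e)$ if and only if $e$ or $e'$ lies in $\{0,1,2,3\}\cup\{e_0,e_0+1,\dots,m\}$ (the integers from $e_0$ up to $m$).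
   Context: For a graph $G$ with degrees $d_1,\dots,d_v$, $P_2(G)=\sum d_i^2$. For $0\le e\le\binom v2$ write $e=\binom{k+1}2-j$ with integers $1\le j\le k$; the quasi-complete graph on $v$ vertices with $e$ edges consists of a complete graph on vertices $1,\dots,k$, a vertex $k+1$ adjacent to vertices $1,\dots,k-j$, and $v-k-1$ isolated vertices; $C(v,e)$ is its $P_2$ value, namely $C(v,e)=j(k-1)^2+(k-j)k^2+(k-j)^2$. The quasi-star graph with $v$ vertices and $e$ edges is the complement of the quasi-complete graph with $v$ vertices and $\binom v2-e$ edges, and $S(v,e)$ is its $P_2$ value. Let $m=\frac12\binom v2$, let $k_0$ be the integer with $\binom{k_0}2\le m<\binom{k_0+1}2$, $e_0=\binom{k_0}2$, $q_0(v)=\frac14\left(1-2(2k_0-3)^2+(2v-5)^2\right)$, and $R_0=\frac{8(m-e_0)(k_0-2)}{-1-2(2k_0-4)^2+(2v-5)^2}$. *)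

(* Defs.v *)
From mathcomp Require Import all_boot all_order all_algebra.
From mathcomp Require Import zify.

Set Implicit Arguments.
Unset Strict Implicit.
Unset Printing Implicit Defensive.

Import Order.TTheory GRing.Theory Num.Theory.

(* A simple graph is given by its adjacency relation; the two graphs used here
   are shown to be symmetric and irreflexive below. *)
Definition degree (T : finType) (G : rel T) (x : T) : nat :=
  #|[set y | G x y]|.

Definition P2 (T : finType) (G : rel T) : nat := \sum_(x : T) degree G x ^ 2.

Definition compl_graph (T : finType) (G : rel T) : rel T :=
  [rel x y | (x != y) && ~~ G x y].

(* The integers k, j with e = 'C(k.+1, 2) - j and 1 <= j <= k: k is the largest
   integer with 'C(k, 2) <= e (always at most e.+1). *)
Definition qc_k (e : nat) : nat := \max_(i < e.+2 | 'C(i, 2) <= e) i.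

Definition qc_j (e : nat) : nat := 'C((qc_k e).+1, 2) - e.

Lemma qc_k_bounds e : 'C(qc_k e, 2) <= e < 'C((qc_k e).+1, 2).
Proof.
have nonempty : 0 < #|[pred i : 'I_e.+2 | 'C(i, 2) <= e]|.
  by apply/card_gt0P; exists ord0; rewrite inE bin0n.
have [i Pi Ei] := eq_bigmax_cond (@nat_of_ord _) nonempty.
have kE : qc_k e = i by exact: Ei.
apply/andP; split; first by rewrite kE.
rewrite ltnNge; apply/negP => Hk.
have k_lt : (qc_k e).+1 < e.+2.
  rewrite ltnNge; apply/negP => He.
  have : 'C(e.+2, 2) <= e by apply: leq_trans Hk; apply: leq_bin2l.
  by rewrite binS bin1; lia.
have : Ordinal k_lt <= qc_k e by apply: leq_bigmax_cond.
by rewrite /= ltnn.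
Qed.

Lemma qc_decomposition e :
  e = 'C((qc_k e).+1, 2) - qc_j e /\ 1 <= qc_j e <= qc_k e.
Proof.
have := qc_k_bounds e; rewrite /qc_j; have := binS (qc_k e) 1.
by rewrite bin1; lia.
Qed.

Lemma qc_decomposition_unique e k j :
  1 <= j <= k -> e = 'C(k.+1, 2) - j -> k = qc_k e /\ j = qc_j e.
Proof.
move=> jk eE.
have kE : k = qc_k e.
  have := qc_k_bounds e; have := binS k 1; rewrite bin1 => kS kb.
  case: (ltngtP k (qc_k e)) => // lt_k.
    by have := leq_bin2l 2 lt_k; lia.
  by have := leq_bin2l 2 lt_k; lia.
by split=> //; rewrite /qc_j -kE; have := binS k 1; rewrite bin1; lia.
Qed.

(* Vertices are numbered from 0, so the clique is {0, .., k - 1} and the extra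
   vertex is k. When e = 'C(v, 2) we have j = k = v: the extra vertex would be
   isolated and is simply absent from 'I_v. *)
Definition quasi_complete (v e : nat) : rel 'I_v :=
  let k := qc_k e in
  let j := qc_j e in
  [rel x y : 'I_v | (x != y) &&
     ((maxn x y < k) || ((maxn x y == k) && (minn x y < k - j)))].
Arguments quasi_complete : clear implicits.

Definition quasi_star (v e : nat) : rel 'I_v :=
  compl_graph (quasi_complete v ('C(v, 2) - e)).
Arguments quasi_star : clear implicits.

Lemma quasi_complete_sym v e : symmetric (quasi_complete v e).
Proof. by move=> x y; rewrite /quasi_complete /= eq_sym maxnC minnC. Qed.

Lemma quasi_complete_irr v e : irreflexive (quasi_complete v e).
Proof. by move=> x; rewrite /quasi_complete /= eqxx. Qed.

Lemma quasi_star_sym v e : symmetric (quasi_star v e).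
Proof.
by move=> x y; rewrite /quasi_star /compl_graph /= eq_sym quasi_complete_sym.
Qed.

Lemma quasi_star_irr v e : irreflexive (quasi_star v e).
Proof. by move=> x; rewrite /quasi_star /compl_graph /= eqxx. Qed.

Definition Cval (v e : nat) : nat := P2 (quasi_complete v e).

Definition Sval (v e : nat) : nat := P2 (quasi_star v e).

Local Open Scope ring_scope.

(* m, q0 and R0 need not be integers; they are rational numbers. *)
Definition m (v : nat) : rat := 'C(v, 2)%:R / 2.

Definition e0 (k0 : nat) : nat := 'C(k0, 2).

Definition q0 (v k0 : nat) : rat :=
  (1 - 2 * (2 * k0%:R - 3) ^+ 2 + (2 * v%:R - 5) ^+ 2) / 4.

(* If q0 v k0 < 0, where k0 is determined by v, the denominator vanishes only
   for v = 4 (k0 = 3); there m v = e0 k0, the numerator vanishes as well, and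
   the value is 0. *)
Definition R0 (v k0 : nat) : rat :=
  8 * (m v - (e0 k0)%:R) * (k0%:R - 2) /
  (-1 - 2 * (2 * k0%:R - 4) ^+ 2 + (2 * v%:R - 5) ^+ 2).

(* Main.v *)
(* Write N = 'C(v, 2) and D(e) = S(v, e) - C(v, e), so that D(N - e) = - D(e).
   If the clique of the quasi-complete graph with e edges has k vertices then
   P_2 is a polynomial qc_poly k e, quadratic in e with leading coefficient 1,
   and qc_poly k e <= qc_poly K e for all K >= 1: the true clique size is a
   minimiser.  Hence on each block 'C(k, 2) <= e <= 'C(k+1, 2) the function D is
   a minimum of affine functions of e, that is, concave, and only its signs at
   triangular numbers and near N/2 matter.  At e = 'C(k, 2), if N - e lies in
   block K, then D(e) > 0 for 4 <= k < k_0: for K = k + 1 it equals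
   (x - v)(x - v + 1) with x = N - 2e, which yields the Pell condition at
   k = k_0; for K = k + 2 it is a quadratic in x, and for K >= k + 3, with v - K
   fixed, a quadratic in v, of negative discriminant up to finitely many cases.
   On the segments of D next to N/2 and next to e_0 the slopes are -q_0 and
   minus a quarter of the denominator of R_0; if q_0 < 0, D changes sign at
   m - R_0. *)

Require Import Defs.
From mathcomp Require Import all_boot all_order all_algebra.
From mathcomp Require Import ring zify.

Import Order.TTheory GRing.Theory Num.Theory.
Local Open Scope ring_scope.

(** * The sums of squared degrees *)

Section Degrees.
Local Open Scope nat_scope.

Lemma card_ord_lt (v a : nat) : a <= v -> #|[set y : 'I_v | y < a]| = a.
Proof.
move=> av; rewrite -sum1dep_card -(big_ord_widen_cond v xpredT (fun=> 1)) //.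
by rewrite sum_nat_const card_ord muln1.
Qed.

Lemma card_ord_lt_neq (v a : nat) (x : 'I_v) :
  a <= v -> x < a -> #|[set y : 'I_v | (y < a) && (y != x)]| = a.-1.
Proof.
move=> av xa; have /(congr1 predn) := card_ord_lt v a av.
rewrite (cardsD1 x) inE xa => <- /=; apply: eq_card => y.
by rewrite !inE andbC.
Qed.

Lemma qc_k_le v e : 0 < v -> e <= 'C(v, 2) -> qc_k e <= v.
Proof.
move=> v0 ev; rewrite leqNgt; apply/negP => lt_v.
have /andP[lo _] := qc_k_bounds e.
by have := leq_bin2l 2 lt_v; rewrite binS bin1; lia.
Qed.

(** If k = v the extra vertex is missing from ['I_v]; j = v gives it the nominal degree k - j =
    0. *)
Lemma qc_j_eq v e : e <= 'C(v, 2) -> qc_k e = v -> qc_j e = v.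
Proof.
move=> ev kv; have /andP[lo _] := qc_k_bounds e.
by rewrite /qc_j kv; have := binS v 1; rewrite bin1; move: lo; rewrite kv; lia.
Qed.

Definition qc_degree (e x : nat) : nat :=
  let k := qc_k e in let j := qc_j e in
  if x < k - j then k else if x < k then k.-1 else if x == k then k - j else 0.

Lemma degree_quasi_complete v e (x : 'I_v) :
  e <= 'C(v, 2) -> degree (quasi_complete v e) x = qc_degree e x.
Proof.
move=> ev; have v0 : 0 < v by case: v x {ev} => // -[].
have kv := qc_k_le v e v0 ev; have [_ jk] := qc_decomposition e.
have jv := qc_j_eq v e ev.
rewrite /degree /qc_degree /quasi_complete.
set k := qc_k e in kv jk jv *; set j := qc_j e in jk jv *.
case: ifP => [x_lt|x_ge].
  have k_lt : k < v.
    by case: (ltngtP k v) => // [|kv']; [lia | have := jv kv'; lia].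
  rewrite -[RHS]/(k.+1.-1) -(card_ord_lt_neq v k.+1 x) //; last by lia.
  by apply: eq_card => y; rewrite !inE /= -!val_eqE /=; lia.
case: ifP => [xk|xk].
  rewrite -[RHS](card_ord_lt_neq v k x) //.
  by apply: eq_card => y; rewrite !inE /= -!val_eqE /=; lia.
case: ifP => [/eqP xk'|xk'].
  rewrite -[RHS](card_ord_lt v (k - j)); last by lia.
  by apply: eq_card => y; rewrite !inE /= -!val_eqE /=; lia.
by apply: eq_card0 => y; rewrite !inE /= -!val_eqE /=; lia.
Qed.

(** Squares give P_2 and the identity gives the degree sum. [G 0 = 0] absorbs the isolated vertices
    and, for k = v, the absent extra vertex. *)
Lemma sum_qc_degree (G : nat -> nat) v e : 0 < v -> e <= 'C(v, 2) -> G 0 = 0 ->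
  let k := qc_k e in let j := qc_j e in
  \sum_(x < v) G (degree (quasi_complete v e) x) =
  (k - j) * G k + j * G k.-1 + G (k - j).
Proof.
move=> v0 ev G0 k j; have kv : k <= v := qc_k_le v e v0 ev.
have [_ jk] := qc_decomposition e; have jv := qc_j_eq v e ev.
rewrite -/k -/j in jk jv.
under eq_bigr => x _ do rewrite degree_quasi_complete //.
rewrite -(big_mkord xpredT (fun x => G (qc_degree e x))).
rewrite (big_cat_nat (n := k - j)) //=; last by lia.
rewrite (big_cat_nat (m := k - j) (n := k)) //=; last by lia.
rewrite (@eq_big_nat _ _ _ 0 (k - j) _ (fun=> G k)); last first.
  by move=> i /andP[_ i_lt]; rewrite /qc_degree -/k -/j i_lt.
rewrite (@eq_big_nat _ _ _ (k - j) k _ (fun=> G k.-1)); last first.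
  by move=> i ij; rewrite /qc_degree -/k -/j ifF ?ifT //; lia.
rewrite !sum_nat_const_nat subn0 subKn ?addnA; last by lia.
congr (_ + _); case: (ltngtP k v) => [k_lt|k_gt|k_eq]; last first.
- by rewrite k_eq big_geq // (jv k_eq) subnn G0.
- by lia.
rewrite big_ltn //; have -> : qc_degree e k = k - j.
  by rewrite /qc_degree -/k -/j ltnn eqxx ifF //; lia.
rewrite big_nat_cond big1 ?addn0 // => i; rewrite andbT => ik.
by rewrite /qc_degree -/k -/j !ifF //; lia.
Qed.

Lemma degree_compl (T : finType) (G : rel T) x : irreflexive G ->
  degree (compl_graph G) x + degree G x = #|T|.-1.
Proof.
move=> irr; rewrite /degree /compl_graph.
have -> : #|T|.-1 = #|~: [set x]|.
  by have := cardsC [set x]; rewrite cards1; lia.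
rewrite -(cardsID [set y | G x y] (~: [set x])) addnC; congr (_ + _).
  by apply: eq_card => y; rewrite !inE; case: eqP => // ->; rewrite irr.
by apply: eq_card => y; rewrite !inE [y == x]eq_sym andbC.
Qed.

End Degrees.

Lemma tri2 (k : nat) : 2 * ('C(k, 2))%:Z = k%:Z * (k%:Z - 1).
Proof. by elim: k => [|k IH]; rewrite ?bin0n // binS bin1; lia. Qed.

(* C(v, e) for e between 'C(k, 2) and 'C(k.+1, 2), both included; the formula is
   also evaluated outside of this block. *)
Definition qc_poly (k : nat) (e : int) : int :=
  let i := e - ('C(k, 2))%:Z in
  k%:Z * (k%:Z - 1) ^+ 2 + (2 * k%:Z - 1) * i + i ^+ 2.

Definition qc_val (e : nat) : int := qc_poly (qc_k e) e%:Z.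

Lemma Cval_eq v e : (0 < v)%N -> (e <= 'C(v, 2))%N -> (Cval v e)%:Z = qc_val e.
Proof.
move=> v0 ev.
have H := sum_qc_degree (fun d => d ^ 2)%N v e v0 ev erefl.
rewrite /Cval /P2 {}H /qc_val /qc_poly.
have [eE jk] := qc_decomposition e; have := binS (qc_k e) 1; rewrite bin1.
move: eE jk; move: (qc_k e) (qc_j e) => k j eE jk kS.
have -> : e%:Z - ('C(k, 2))%:Z = k%:Z - j%:Z by lia.
have k1 : (0 < k)%N by lia.
rewrite -!mulnn !PoszD !PoszM.
have -> : (k - j)%N%:Z = k%:Z - j%:Z by lia.
have -> : k.-1%:Z = k%:Z - 1 by lia.
ring.
Qed.

(** Complementation turns a degree d into v - 1 - d; expanding the square leaves P_2 of the
    quasi-complete graph with N - e edges, N = 'C(v, 2), and its degree sum 2 (N - e). *)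
Lemma Sval_eq v e : (0 < v)%N -> (e <= 'C(v, 2))%N ->
  (Sval v e)%:Z = qc_val ('C(v, 2) - e)%N +
    2 * (v%:Z - 1) * (2 * e%:Z - ('C(v, 2))%:Z).
Proof.
move=> v0 ev; set f := ('C(v, 2) - e)%N.
have fv : (f <= 'C(v, 2))%N by rewrite leq_subr.
have Hs := sum_qc_degree id v f v0 fv erefl.
rewrite -(Cval_eq v) //.
have Sdeg : (\sum_(x < v) degree (quasi_complete v f) x)%N = f.*2.
  rewrite Hs; have [eE jk] := qc_decomposition f; have := tri2 (qc_k f).
  have := binS (qc_k f) 1; rewrite bin1; move: eE jk.
  move: (qc_k f) (qc_j f) => k j /=.
  by case: k => [|k] /=; nia.
have -> : (Sval v e)%:Z = \sum_(x < v) ((v%:Z - 1) ^+ 2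
    - 2 * (v%:Z - 1) * (degree (quasi_complete v f) x)%:Z
    + (degree (quasi_complete v f) x ^ 2)%:Z).
  rewrite /Sval /P2 /quasi_star -/f (big_morph Posz PoszD erefl).
  apply: eq_bigr => x _.
  have := degree_compl _ _ x (@quasi_complete_irr v f).
  rewrite card_ord -/f; set a := degree _ x; set b := degree _ x => ab.
  have aE : a%:Z = v%:Z - 1 - b%:Z by lia.
  by rewrite -!mulnn !PoszM aE; ring.
rewrite !big_split /= sumr_const card_ord sumrN -mulr_sumr.
rewrite -!(big_morph Posz PoszD erefl) Sdeg /Cval /P2.
rewrite -[_ *+ v]mulr_natr natz.
have -> : (f.*2)%:Z = 2 * (('C(v, 2))%:Z - e%:Z) by lia.
have -> : (v%:Z - 1) ^+ 2 * v%:Z = (v%:Z - 1) * (2 * ('C(v, 2))%:Z).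
  by rewrite tri2; ring.
by ring.
Qed.

(** * Concavity of the difference on blocks *)

Lemma triS (k : nat) : 'C(k.+1, 2) = ('C(k, 2) + k)%N.
Proof. by rewrite binS bin1. Qed.

(** The difference is affine with zero at 'C(k+1, 2): its sign gives minimality, its zero lets
    blocks contain both ends. *)
Lemma qc_polyS k e : qc_poly k.+1 e =
  qc_poly k e + 2 * (k%:Z - 1) * (('C(k.+1, 2))%:Z - e).
Proof. by rewrite /qc_poly triS PoszD -addn1 PoszD; ring. Qed.

Lemma qc_k_gt0 e : (0 < qc_k e)%N.
Proof. by have [_ /andP[]] := qc_decomposition e; apply: leq_trans. Qed.

Lemma qc_poly_up d k e : (0 < k)%N -> e <= ('C(k.+1, 2))%:Z ->
  qc_poly k e <= qc_poly (k + d) e.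
Proof.
move=> k0 ek; elim: d => [|d IH]; first by rewrite addn0.
rewrite addnS qc_polyS; have := leq_bin2l 2 (leq_addr d k.+1).
rewrite addSn; nia.
Qed.

Lemma qc_poly_down d k e : (0 < k)%N -> ('C(k + d, 2))%:Z <= e ->
  qc_poly (k + d) e <= qc_poly k e.
Proof.
move=> k0; elim: d => [|d IH] ed; first by rewrite addn0.
move: ed; rewrite addnS qc_polyS => ed.
by have := leq_bin2l 2 (leqnSn (k + d)); nia.
Qed.

Lemma qc_val_le k e : (0 < k)%N -> qc_val e <= qc_poly k e%:Z.
Proof.
move=> k0; have /andP[lo hi] := qc_k_bounds e; have q0 := qc_k_gt0 e.
rewrite /qc_val; case: (leqP (qc_k e) k) => [qk|kq].
  by rewrite -(subnKC qk); apply: qc_poly_up => //; lia.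
rewrite -(subnKC (ltnW kq)).
by apply: qc_poly_down; rewrite // subnKC ?(ltnW kq).
Qed.

Lemma qc_val_block k e : (0 < k)%N -> ('C(k, 2) <= e <= 'C(k.+1, 2))%N ->
  qc_val e = qc_poly k e%:Z.
Proof.
move=> k0 /andP[ek ek']; have /andP[lo hi] := qc_k_bounds e.
rewrite /qc_val; move: lo hi; move: (qc_k e) => q lo hi.
case: (ltngtP q k) => [qk|kq|-> //].
  by have := leq_bin2l 2 qk; lia.
move: (kq); rewrite leq_eqVlt => /orP[/eqP<-|kq'].
  have : 'C(k.+1, 2) = e by have := leq_bin2l 2 kq; lia.
  by rewrite qc_polyS => ->; rewrite subrr mulr0 addr0.
by have := leq_bin2l 2 kq'; rewrite triS; lia.
Qed.

Definition diff (v e : nat) : int :=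
  qc_val ('C(v, 2) - e)%N - qc_val e
  - 2 * (v%:Z - 1) * (('C(v, 2))%:Z - 2 * e%:Z).

Lemma diff_Sval_Cval v e : (0 < v)%N -> (e <= 'C(v, 2))%N ->
  (Sval v e)%:Z - (Cval v e)%:Z = diff v e.
Proof. by move=> v0 ev; rewrite Sval_eq // Cval_eq // /diff; ring. Qed.

Lemma diff_sub v e : (e <= 'C(v, 2))%N -> diff v ('C(v, 2) - e) = - diff v e.
Proof. by move=> ev; rewrite /diff subKn // -subzn //; ring. Qed.

(** This is D(e) for e in block k and N - e in block K; on block k, D is the minimum of these over
    K. *)
Definition diff_poly (v k K : nat) (e : int) : int :=
  qc_poly K (('C(v, 2))%:Z - e) - qc_poly k e
  - 2 * (v%:Z - 1) * (('C(v, 2))%:Z - 2 * e).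

Lemma diff_le_poly v k K e : (0 < k)%N -> (0 < K)%N -> (e <= 'C(v, 2))%N ->
  ('C(k, 2) <= e <= 'C(k.+1, 2))%N -> diff v e <= diff_poly v k K e%:Z.
Proof.
move=> k0 K0 ev ek; rewrite /diff /diff_poly (qc_val_block k e) // subzn //.
by have := qc_val_le K ('C(v, 2) - e)%N K0; lia.
Qed.

Lemma diff_block v k K e : (0 < k)%N -> (0 < K)%N -> (e <= 'C(v, 2))%N ->
  ('C(k, 2) <= e <= 'C(k.+1, 2))%N ->
  ('C(K, 2) <= 'C(v, 2) - e <= 'C(K.+1, 2))%N ->
  diff v e = diff_poly v k K e%:Z.
Proof.
move=> k0 K0 ev ek eK.
by rewrite /diff /diff_poly (qc_val_block k e) // (qc_val_block K) // subzn.
Qed.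

(* The quadratic terms cancel: [diff_poly v k K] is affine. *)
Lemma diff_poly_affine v k K (e1 e e2 : int) :
  (e2 - e1) * diff_poly v k K e =
  (e2 - e) * diff_poly v k K e1 + (e - e1) * diff_poly v k K e2.
Proof. by rewrite /diff_poly /qc_poly; ring. Qed.

(* On a block, [diff v] is a minimum of affine functions. *)
Lemma diff_concave v k e1 e e2 : (0 < k)%N ->
  ('C(k, 2) <= e1)%N -> (e1 <= e <= e2)%N -> (e2 <= 'C(k.+1, 2))%N ->
  (e2 <= 'C(v, 2))%N ->
  (e2%:Z - e%:Z) * diff v e1 + (e%:Z - e1%:Z) * diff v e2 <=
  (e2%:Z - e1%:Z) * diff v e.
Proof.
move=> k0 lo /andP[e1e ee2] hi ev; set f := ('C(v, 2) - e)%N.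
have K0 := qc_k_gt0 f; have /andP[Klo Khi] := qc_k_bounds f.
rewrite (diff_block v k (qc_k f) e) ?(diff_poly_affine _ _ _ e1 _ e2); try lia.
have H1 := diff_le_poly v k (qc_k f) e1 k0 K0.
have H2 := diff_le_poly v k (qc_k f) e2 k0 K0.
by apply: lerD; apply: ler_wpM2l; rewrite ?subr_ge0 ?lez_nat ?H1 ?H2; lia.
Qed.

(** * The difference at triangular numbers *)

(* Minus the discriminant, up to a positive factor, of [diff_poly] at
   e = 'C(k, 2) with K = v - L, as a quadratic polynomial in v. *)
Definition qform (k L : int) : int :=
  let w := k * (k - 1) in
  w ^+ 2 + 4 * L ^+ 2 * w - 2 * L * w - 4 * L * (k - 1) * w
  - L ^+ 2 * (L - 1) * (L + 2).

Lemma diff_poly_tri (v k K : nat) (L : int) : v%:Z = K%:Z + L ->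
  4 * L * diff_poly v k K ('C(k, 2))%:Z =
  (L - 1) * (2 * L * v%:Z - k%:Z * (k%:Z - 1) - L * (L + 2)) ^+ 2 +
  qform k%:Z L.
Proof.
move=> vE; have -> : 4 * L * diff_poly v k K ('C(k, 2))%:Z =
  L * (4 * K%:Z * (K%:Z - 1) ^+ 2
    + 2 * (2 * K%:Z - 1) * (2 * ('C(v, 2))%:Z - 2 * ('C(k, 2))%:Z
                            - 2 * ('C(K, 2))%:Z)
    + (2 * ('C(v, 2))%:Z - 2 * ('C(k, 2))%:Z - 2 * ('C(K, 2))%:Z) ^+ 2
    - 4 * k%:Z * (k%:Z - 1) ^+ 2
    - 4 * (v%:Z - 1) * (2 * ('C(v, 2))%:Z - 2 * (2 * ('C(k, 2))%:Z))).
  by rewrite /diff_poly /qc_poly; ring.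
by rewrite !tri2 vE /qform; ring.
Qed.

Lemma diff_poly_tri1 (v k : nat) :
  let x := ('C(v, 2))%:Z - 2 * ('C(k, 2))%:Z in
  diff_poly v k k.+1 ('C(k, 2))%:Z = (x - v%:Z) * (x - v%:Z + 1).
Proof.
rewrite /diff_poly /qc_poly triS.
by have := tri2 v; have := tri2 k; lia.
Qed.

Lemma diff_poly_tri2 (v k : nat) :
  let x := ('C(v, 2))%:Z - 2 * ('C(k, 2))%:Z in
  diff_poly v k k.+2 ('C(k, 2))%:Z =
  x ^+ 2 - (2 * v%:Z + 2 * k%:Z + 3) * x + 3 * v%:Z ^+ 2 - 3 * v%:Z + 6 * k%:Z.
Proof.
rewrite /diff_poly /qc_poly !triS.
by have := tri2 v; have := tri2 k; lia.
Qed.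

Lemma qform1_gt0 (k : int) : 4 <= k -> 0 < qform k 1.
Proof.
move=> k4; have -> : qform k 1 = (k * (k - 1)) * ((k - 2) * (k - 3)).
  by rewrite /qform; ring.
by rewrite !mulr_gt0 ?subr_gt0 //; lia.
Qed.

(** The last hypothesis is what membership of N - e in block v - L >= k + 3 implies. At the three
    listed pairs [qform] is negative. *)
Lemma qform_gt0_small (k L : nat) : (4 <= k)%N -> (2 <= L < 12)%N ->
  0 <= k%:Z ^+ 2 - 2 * k%:Z * L%:Z - L%:Z ^+ 2 - 5 * L%:Z + k%:Z + 6 ->
  0 < qform k%:Z L%:Z \/ (k, L) \in [:: (5, 2); (10, 4); (15, 6)]%N.
Proof.
move=> k4 L2.
have shift km : (km <= k)%N -> exists d : nat, k = (d + km)%N.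
  by move=> kmk; exists (k - km)%N; lia.
have L_cases : (L = 2 \/ L = 3 \/ L = 4 \/ L = 5 \/ L = 6 \/ L = 7 \/ L = 8 \/
  L = 9 \/ L = 10 \/ L = 11)%N by lia.
rewrite /qform !inE !xpair_eqE.
(* Each threshold is the least k allowed by the last hypothesis, plus one for L = 2, 4, 6, where
   that least k is exceptional. *)
case: L_cases => [->|[->|[->|[->|[->|[->|[->|[->|[->|->]]]]]]]]].
- by case: (leqP 6 k) => [/shift[d ->]|km]; nia.
- by case: (leqP 8 k) => [/shift[d ->]|km]; nia.
- by case: (leqP 11 k) => [/shift[d ->]|km]; nia.
- by case: (leqP 13 k) => [/shift[d ->]|km]; nia.
- by case: (leqP 16 k) => [/shift[d ->]|km]; nia.
- by case: (leqP 18 k) => [/shift[d ->]|km]; nia.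
- by case: (leqP 20 k) => [/shift[d ->]|km]; nia.
- by case: (leqP 23 k) => [/shift[d ->]|km]; nia.
- by case: (leqP 25 k) => [/shift[d ->]|km]; nia.
- by case: (leqP 28 k) => [/shift[d ->]|km]; nia.
Qed.

(** For 2k < 5L, division by s leaves a nonnegative multiple of s and a remainder, linear in k, that
    is positive as L >= 12; for 2k >= 5L the quartic is positive by itself. *)
Lemma qform_gt0_large (k L : int) : 12 <= L -> 4 <= k ->
  0 <= k ^+ 2 - 2 * k * L - L ^+ 2 - 5 * L + k + 6 -> 0 < qform k L.
Proof.
move=> L12 k4; set s := (X in 0 <= X) => s0.
have [k_lt|k_ge] := ltP (2 * k) (5 * L).
  have -> : qform k L = ((k - L) ^+ 2 - 3 * (k - L) + 4 * L - 2) * s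
      + (11 * L ^+ 3 + 29 * L ^+ 2 - 52 * L + 12 - 4 * (L + 5) * (L - 1) * k).
    by rewrite /qform /s; ring.
  apply: ltr_wpDl; first by rewrite mulr_ge0 //; nia.
  have : 0 <= (L + 5) * (L - 1) * (5 * L - 2 * k) by do 2?apply: mulr_ge0; lia.
  have : 0 <= (L - 12) * L ^+ 2 by apply: mulr_ge0; rewrite ?sqr_ge0 //; lia.
  have : 0 <= (L - 12) * L by apply: mulr_ge0; lia.
  by lia.
have [l LE] : exists l : nat, L = l%:Z + 12 by exists `|(L - 12)%R|%N; lia.
have [h hE] : exists h : nat, 2 * k = 5 * (l%:Z + 12) + h%:Z.
  by exists `|(2 * k - 5 * L)%R|%N; lia.
rewrite LE.
rewrite -(pmulr_rgt0 _ (isT : 0 < 16 :> int)).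
have -> : 16 * qform k (l%:Z + 12) =
   (2 * k) * (2 * k - 2) * (2 * k) * (2 * k - 2)
   + 16 * (l%:Z + 12) ^+ 2 * (2 * k) * (2 * k - 2)
   - 8 * (l%:Z + 12) * (2 * k) * (2 * k - 2)
   - 8 * (l%:Z + 12) * (2 * k - 2) * (2 * k) * (2 * k - 2)
   - 16 * (l%:Z + 12) ^+ 2 * (l%:Z + 11) * (l%:Z + 14).
  by rewrite /qform; ring.
have {hE}-> : 2 * k = 5 * l%:Z + 60 + h%:Z by lia.
by nia.
Qed.

Lemma diff_poly_tri1_gt0 (v k : nat) : (4 <= k)%N ->
  (2 * 'C(k.+1, 2) <= 'C(v, 2) <= 'C(k, 2) + 'C(k.+2, 2))%N ->
  0 < diff_poly v k k.+1 ('C(k, 2))%:Z.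
Proof.
move=> k4 /andP[lo hi]; rewrite diff_poly_tri1.
have := tri2 v; have := tri2 k; move: lo hi; rewrite !triS => lo hi Tk Tv.
(* Hence x >= 2k > v, and both factors are positive. *)
have v_lt : (v < 2 * k)%N by nia.
by apply: mulr_gt0; lia.
Qed.

Lemma diff_poly_tri2_gt0 (v k : nat) : (4 <= k)%N ->
  ('C(k, 2) + 'C(k.+2, 2) <= 'C(v, 2))%N ->
  0 < diff_poly v k k.+2 ('C(k, 2))%:Z.
Proof.
move=> k4 lo; rewrite diff_poly_tri2.
have := tri2 v; have := tri2 k; move: lo; rewrite !triS => lo Tk Tv.
set x := ('C(v, 2))%:Z - 2 * ('C(k, 2))%:Z.
(* With d = v - k, four times the quadratic is a square plus a term nonnegative by [lo] plus 4 d^2 -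
   20 d - 1, which is positive from d = 6 on; d <= 5 forces k <= 9. *)
have [far|near] := leqP (k + 6) v.
  have : 0 < (2 * x - (2 * v%:Z + 2 * k%:Z + 3)) ^+ 2
    + (4 * (v%:Z ^+ 2 - v%:Z - 2 * k%:Z ^+ 2 - 2 * k%:Z - 2)
    + (4 * (v%:Z - k%:Z) ^+ 2 - 20 * (v%:Z - k%:Z) - 1)).
    apply: ltr_wpDl; first by rewrite sqr_ge0.
    by apply: ltr_wpDl; [lia | nia].
  by lia.
have kv : (k < v)%N by nia.
have k9 : (k <= 9)%N by nia.
have x2 : 2 * x = v%:Z * (v%:Z - 1) - 2 * (k%:Z * (k%:Z - 1)).
  by rewrite /x -Tv -Tk; ring.
suff : 0 < (2 * x) ^+ 2 - 2 * (2 * v%:Z + 2 * k%:Z + 3) * (2 * x)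
    + 12 * v%:Z ^+ 2 - 12 * v%:Z + 24 * k%:Z by lia.
have : v%:Z * (v%:Z - 1) >= 2 * k%:Z ^+ 2 + 2 * k%:Z + 2 by lia.
rewrite {}x2; move: k4 near kv k9; clear.
have k_cases : (4 <= k)%N -> (k <= 9)%N ->
  (k = 4 \/ k = 5 \/ k = 6 \/ k = 7 \/ k = 8 \/ k = 9)%N by lia.
have v_cases : (v < k + 6)%N -> (k < v)%N ->
  (v = k + 1 \/ v = k + 2 \/ v = k + 3 \/ v = k + 4 \/ v = k + 5)%N by lia.
move=> k4 /v_cases vE /vE + k9; have := k_cases k4 k9.
by case=> [|[|[|[|[]]]]] ->; case=> [|[|[|[]]]] ->; lia.
Qed.

(** In [diff_poly_tri] the square has the factor L - 1 >= 0, so positivity of [qform] suffices; at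
    its three exceptions [M_le] bounds t and the square is evaluated. *)
Lemma diff_poly_tri3_gt0 (v k K : nat) : (4 <= k)%N -> (k + 3 <= K < v)%N ->
  ('C(v, 2) <= 'C(k, 2) + 'C(K.+1, 2))%N ->
  0 < diff_poly v k K ('C(k, 2))%:Z.
Proof.
move=> k4 /andP[kK Kv] hi; set L := (v - K)%N.
have vE : v%:Z = K%:Z + L%:Z by rewrite /L; lia.
have L_gt0 : (0 < L)%N by rewrite /L; lia.
have DE := diff_poly_tri v k K L vE.
have L4 : 0 < 4 * L%:Z :> int by rewrite mulr_gt0 // ltz_nat.
have suff_qform : 0 < qform k%:Z L%:Z -> 0 < diff_poly v k K ('C(k, 2))%:Z.
  move=> q0; rewrite -(pmulr_rgt0 _ L4) DE; apply: ltr_wpDl => //.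
  by rewrite mulr_ge0 ?sqr_ge0; lia.
have := tri2 v; have := tri2 k; have := tri2 K.
move: hi; rewrite triS => hi TK Tk Tv.
have [L1|L2] := leqP L 1.
  have L_eq1 : L = 1%N by lia.
  by apply: suff_qform; rewrite L_eq1; apply: qform1_gt0; lia.
have [t tE] : exists t : nat, K = (k + 3 + t)%N by exists (K - k - 3)%N; lia.
(* This is the upper bound on N; dropping t yields the hypothesis of the [qform] lemmas. *)
have M_le : (L%:Z + k%:Z) ^+ 2 - 2 * k%:Z ^+ 2 <=
    L%:Z + k%:Z - 2 * (t%:Z + 3) * (L%:Z - 1).
  by move: hi TK Tv; rewrite vE tE; lia.
have s0 : 0 <= k%:Z ^+ 2 - 2 * k%:Z * L%:Z - L%:Z ^+ 2 - 5 * L%:Z + k%:Z + 6.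
  have : 0 <= t%:Z * (L%:Z - 1) by apply: mulr_ge0; lia.
  by lia.
have [L12|L12] := leqP 12 L.
  by apply: suff_qform; apply: qform_gt0_large; lia.
have L_small : (2 <= L < 12)%N by lia.
case: (qform_gt0_small k L k4 L_small s0) => [/suff_qform //|].
rewrite !inE !xpair_eqE -(pmulr_rgt0 _ L4).
move: M_le; rewrite DE vE tE /qform; move: (L); clear.
move=> L M_le /or3P[] /andP[/eqP kE /eqP LE].
all: move: M_le; rewrite {}kE {}LE => M_le.
- have : (t = 0 \/ t = 1)%N by lia.
  by case=> ->; lia.
- have -> : t = 0%N by lia.
  by lia.
- have -> : t = 0%N by lia.
  by lia.
Qed.

(** Here k < k_0, so N - 'C(k, 2) lies in a block K > k, and K < v because 'C(k, 2) > 0; the cases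
    are K = k + 1, K = k + 2 and K >= k + 3. *)
Lemma diff_tri_gt0 (v k : nat) : (4 <= k)%N ->
  (2 * 'C(k.+1, 2) <= 'C(v, 2))%N ->
  0 < diff v 'C(k, 2).
Proof.
move=> k4 lo; have [f fE] : exists f, f = ('C(v, 2) - 'C(k, 2))%N.
  by exists ('C(v, 2) - 'C(k, 2))%N.
have k0 : (0 < k)%N by lia.
have kT := triS k; have T0 : (0 < 'C(k, 2))%N by rewrite bin_gt0; lia.
have K0 := qc_k_gt0 f; have /andP[Klo Khi] := qc_k_bounds f.
have kK : (k < qc_k f)%N.
  rewrite ltnNge; apply/negP => Kk.
  by have := @leq_bin2l (qc_k f).+1 k.+1 2 Kk; lia.
have Kv : (qc_k f < v)%N.
  by rewrite ltnNge; apply/negP => vK; have := leq_bin2l 2 vK; lia.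
rewrite (diff_block v k (qc_k f)) -?fE; try lia.
case: (ltngtP (qc_k f) k.+1) => [||K_eq]; first by lia.
  rewrite leq_eqVlt => /orP[/eqP K_eq|K3].
    by rewrite -K_eq; apply: diff_poly_tri2_gt0 => //; rewrite K_eq; lia.
  by apply: diff_poly_tri3_gt0 => //; lia.
move: Khi; rewrite K_eq => Khi; apply: diff_poly_tri1_gt0 => //; lia.
Qed.

(** * The segments next to the middle *)

(** For v >= 2, e lies in block 1 or 2 and N - e in block v - 1, where the affine formula vanishes;
    v = 1 admits only e = 0. *)
Lemma diff_le3 v e : (0 < v)%N -> (e <= 3)%N -> (2 * e <= 'C(v, 2))%N ->
  diff v e = 0.
Proof.
case: v => [//|w] _ e3 ev; have Tv := tri2 w.+1; have Tw := tri2 w.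
have vw := triS w.
have [w0|w_gt0] := leqP w 0.
  have w_eq : w = 0%N by lia.
  rewrite w_eq in ev *.
  have -> : e = 0%N by move: ev; rewrite bin_small //; lia.
  by rewrite /diff bin_small // subnn !subrr; ring.
have ew : (e <= w)%N by nia.
have [C1 C2 C3] : [/\ 'C(1, 2) = 0, 'C(2, 2) = 1 & 'C(3, 2) = 3]%N by [].
have Tw' : w%:Z * (2 * ('C(w, 2))%:Z) = w%:Z * (w%:Z * (w%:Z - 1)).
  by rewrite Tw.
have [e1|e2] := leqP e 1.
  rewrite (diff_block _ 1 w); try lia.
  rewrite /diff_poly /qc_poly vw C1.
  have [->|->] : e = 0%N \/ e = 1%N by lia.
    by lia.
  by lia.
rewrite (diff_block _ 2 w); try lia.
rewrite /diff_poly /qc_poly vw C2.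
have [->|->] : e = 2%N \/ e = 3%N by lia.
  by lia.
by lia.
Qed.

(* Minus the slope of [diff v] on the segment where the blocks of e and of
   'C(v, 2) - e are both k, resp. are k - 1 and k. *)
Definition slope_mid (v k : nat) : int :=
  v%:Z ^+ 2 - 5 * v%:Z + 2 - 2 * k%:Z ^+ 2 + 6 * k%:Z.

Definition slope_low (v k : nat) : int := slope_mid v k + 2 * k%:Z - 4.

(** Twice D where e is in block k - 1 and N - e in block k; if [slope_low] is positive, its zero in
    e is m - R_0. *)
Definition low_line (v k : nat) (e : int) : int :=
  slope_low v k * (('C(v, 2))%:Z - 2 * e)
  - 2 * (('C(v, 2))%:Z - 2 * ('C(k, 2))%:Z) * (k%:Z - 2).

Lemma diff_poly_mid v k e :
  2 * diff_poly v k k e = (('C(v, 2))%:Z - 2 * e) * slope_mid v k.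
Proof.
have -> : slope_mid v k =
    2 * ('C(v, 2))%:Z - 4 * v%:Z + 2 - 2 * (2 * ('C(k, 2))%:Z) + 4 * k%:Z.
  by rewrite !tri2 /slope_mid; ring.
by rewrite /diff_poly /qc_poly; ring.
Qed.

Lemma diff_poly_low v k e : 2 * diff_poly v k k.+1 e = low_line v k.+1 e.
Proof.
have kS : k.+1%:Z = k%:Z + 1 by lia.
rewrite /low_line.
have -> : slope_low v k.+1 =
    2 * ('C(v, 2))%:Z - 4 * v%:Z + 4 - 2 * (2 * ('C(k, 2))%:Z) + 2 * k%:Z.
  by rewrite !tri2 /slope_low /slope_mid kS; ring.
rewrite /diff_poly /qc_poly triS PoszD kS.
have Tk := tri2 k.
have kTk : k%:Z * (2 * ('C(k, 2))%:Z) = k%:Z * (k%:Z * (k%:Z - 1)).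
  by rewrite Tk.
move: ('C(v, 2))%:Z ('C(k, 2))%:Z Tk kTk => N T Tk kTk.
by lia.
Qed.

(** As N > k^2, the slope is at least 6k + 4 - 4v; and 4v > 6k + 3 would push N up to 2 'C(k+1,
    2). *)
Lemma slope_mid_gt0 v k : ('C(v, 2) < 2 * 'C(k.+1, 2))%N ->
  (k ^ 2 < 'C(v, 2))%N -> 0 < slope_mid v k.
Proof.
rewrite -mulnn triS => hi lo; have := tri2 v; have := tri2 k.
rewrite /slope_mid => Tk Tv.
have [v_le|v_gt] := leqP (4 * v) (6 * k + 3); first by lia.
have k2 : (2 <= k)%N by nia.
by nia.
Qed.

(* Twice the value of [low_line] where 'C(v, 2) - e = 'C(k.+1, 2). *)
Definition low_end (v k : nat) : int :=
  slope_low v k * (2 * (k%:Z * (k%:Z + 1)) - v%:Z * (v%:Z - 1))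
  - 2 * (v%:Z * (v%:Z - 1) - 2 * (k%:Z * (k%:Z - 1))) * (k%:Z - 2).

(* Conditionals, unlike boolean connectives, keep [vm_compute] lazy. *)
Definition low_check (v k : nat) : bool :=
  if (2 * (k * k.-1) <= v * v.-1)%N then
    if (v * v.-1 < 2 * (k * k.+1))%N then
      if (slope_mid v k < 0)%R then
        (0 < slope_low v k)%R &&
        (if (v * v.-1 <= 2 * k ^ 2)%N then (0 < low_end v k)%R else true)
      else true
    else true
  else true.

(** For k <= 28, v (v - 1) < 2k (k + 1) gives v < 43, so this range holds all small cases of
    [low_facts]. *)
Lemma low_check_small (v k : nat) : (5 <= v < 43)%N -> (k < 29)%N ->
  low_check v k.
Proof.
move=> v5 k29.
have : all (fun k => all (low_check^~ k) (iota 5 38)) (iota 0 29) by vm_compute.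
move=> /allP /(_ k) /[!mem_iota] /(_ k29) /allP /(_ v).
by rewrite mem_iota; apply.
Qed.

Lemma low_facts (v k : nat) : (5 <= v)%N ->
  (2 * 'C(k, 2) <= 'C(v, 2) < 2 * 'C(k.+1, 2))%N -> slope_mid v k < 0 ->
  0 < slope_low v k /\
  (('C(v, 2) <= k ^ 2)%N ->
   0 < low_line v k (('C(v, 2))%:Z - ('C(k.+1, 2))%:Z)).
Proof.
move=> v5 /andP[lo hi] mid_lt0; have Tk := tri2 k; have Tv := tri2 v.
have TS := triS k.
have low_lineE : 2 * low_line v k (('C(v, 2))%:Z - ('C(k.+1, 2))%:Z) =
    low_end v k.
  rewrite /low_line /low_end -Tv -Tk TS PoszD.
  have -> : k%:Z * (k%:Z + 1) = 2 * ('C(k, 2))%:Z + 2 * k%:Z.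
    by rewrite Tk; ring.
  by ring.
have low_checkP : low_check v k -> 0 < slope_low v k /\
  (('C(v, 2) <= k ^ 2)%N -> 0 < low_end v k).
  rewrite /low_check mid_lt0 ifT; last by nia.
  rewrite ifT; last by nia.
  case/andP=> -> end_gt0; split=> // Nk.
  by rewrite ifT // -mulnn in end_gt0; move: Nk; rewrite -mulnn; nia.
suff : 0 < slope_low v k /\ (('C(v, 2) <= k ^ 2)%N -> 0 < low_end v k).
  by case=> s0 e0; split=> // /e0; rewrite -low_lineE; lia.
have [k29|k29] := ltnP k 29.
  by apply/low_checkP/low_check_small => //; nia.
have kv : (4 * v + 6 <= 6 * k)%N by nia.
split; first by rewrite /slope_low /slope_mid; lia.
rewrite -mulnn => Nk.
(* z = k^2 - N is at most k; the bracket below is k (6k - 4v - 6) + z (6k - 4v - 6) + 2z (k - z) +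
   8k. *)
have [z zE] : exists z : nat, v%:Z * (v%:Z - 1) = 2 * k%:Z ^+ 2 - 2 * z%:Z.
  by exists (k * k - 'C(v, 2))%N; lia.
have zk : (z <= k)%N by lia.
have -> : low_end v k = 2 * (6 * k%:Z ^+ 2 - 4 * v%:Z * k%:Z + 2 * k%:Z
   + 8 * k%:Z * z%:Z
   - 4 * v%:Z * z%:Z - 6 * z%:Z - 2 * z%:Z ^+ 2).
  rewrite /low_end /slope_low /slope_mid zE.
  have -> : v%:Z ^+ 2 = v%:Z + 2 * k%:Z ^+ 2 - 2 * z%:Z by lia.
  by ring.
have : 0 <= z%:Z * (k%:Z - z%:Z) by apply: mulr_ge0; lia.
have : 0 <= z%:Z * (6 * k%:Z - 4 * v%:Z - 6) by apply: mulr_ge0; lia.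
have : 0 <= k%:Z * (6 * k%:Z - 4 * v%:Z - 6) by apply: mulr_ge0; lia.
by lia.
Qed.

(** * Signs on the lower half *)

(** Concavity between 'C(k, 2), where D > 0 if k >= 4, and e2. For k = 3 the left end has D(3) = 0,
    so D(e2) must be positive. *)
Lemma diff_gt0_block v k e e2 : (0 < v)%N -> (3 <= k)%N ->
  ('C(k, 2) <= e < e2)%N -> (e2 <= 'C(k.+1, 2))%N -> (3 < e)%N ->
  (2 * 'C(k.+1, 2) <= 'C(v, 2))%N -> 0 <= diff v e2 ->
  (4 <= k)%N \/ 0 < diff v e2 -> 0 < diff v e.
Proof.
move=> v0 k3 /andP[lo ee2] hi e3 Nk D2 strict.
have k0 : (0 < k)%N by lia.
have Tk : ('C(3, 2) <= 'C(k, 2))%N := leq_bin2l 2 k3.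
have kS := triS k.
have := diff_concave v k 'C(k, 2) e e2 k0 (leqnn _).
rewrite lo (ltnW ee2) => /(_ isT hi) Dconc.
have {}Dconc := Dconc ltac:(lia).
suff : 0 < (e2%:Z - 'C(k, 2)%:Z) * diff v e by rewrite pmulr_rgt0 //; lia.
apply: lt_le_trans Dconc.
have [k4|k_lt4] := leqP 4 k.
  by apply: ltr_pwDl; [apply: mulr_gt0; rewrite ?diff_tri_gt0 //; lia |
                       apply: mulr_ge0; lia].
have k_eq : k = 3%N by lia.
case: strict => [k4|D2_gt0]; first by lia.
rewrite k_eq in lo Nk *; have C3 : 'C(3, 2) = 3%N by [].
have C4 : 'C(4, 2) = 6%N by [].
rewrite C3 (diff_le3 v 3) //; last by lia.
by rewrite mulr0 add0r; apply: mulr_gt0; lia.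
Qed.

(** On the block of e, the right end is either the given ['C(k0, 2)] or a smaller triangular number,
    where D > 0 by [diff_tri_gt0]. *)
Lemma diff_gt0_below v k0 e : (0 < v)%N -> (3 < e < 'C(k0, 2))%N ->
  (2 * 'C(k0, 2) <= 'C(v, 2))%N -> 0 <= diff v 'C(k0, 2) ->
  (5 <= k0)%N \/ 0 < diff v 'C(k0, 2) -> 0 < diff v e.
Proof.
move=> v0 /andP[e3 e_lt] Nk0 D0 strict.
have /andP[lo hi] := qc_k_bounds e; set k := qc_k e in lo hi.
have k_lt : (k < k0)%N.
  by rewrite ltnNge; apply/negP => kk; have := leq_bin2l 2 kk; lia.
have k3 : (3 <= k)%N.
  rewrite leqNgt; apply/negP => k2; have := @leq_bin2l k.+1 3 2 k2.
  by rewrite (_ : 'C(3, 2) = 3)%N //; lia.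
have Nk : (2 * 'C(k.+1, 2) <= 'C(v, 2))%N.
  by have := leq_bin2l 2 k_lt; lia.
apply: (diff_gt0_block v k e 'C(k.+1, 2)) => //; first by rewrite lo.
  move: k_lt; rewrite leq_eqVlt => /orP[/eqP-> //|k_lt].
  by apply/ltW/diff_tri_gt0; [lia | have := leq_bin2l 2 k_lt; lia].
move: k_lt; rewrite leq_eqVlt => /orP[/eqP kE|k_lt].
  by rewrite kE; case: strict => ?; [left; lia | right].
right; apply: diff_tri_gt0; first by lia.
by have := leq_bin2l 2 k_lt; lia.
Qed.

Section Middle.
Variables (v k : nat).
Hypothesis v_gt0 : (0 < v)%N.
(** This brackets m, doubled: throughout the section k is the k_0 of v. *)
Hypothesis mid : (2 * 'C(k, 2) <= 'C(v, 2) < 2 * 'C(k.+1, 2))%N.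

Lemma mid_k_gt0 : (0 < k)%N.
Proof. by move: mid; case: (k) => //=; rewrite !bin_small //; lia. Qed.

Lemma diff_mid e : ('C(k, 2) <= e)%N -> (2 * e <= 'C(v, 2))%N ->
  ('C(v, 2) <= e + 'C(k.+1, 2))%N ->
  2 * diff v e = (('C(v, 2))%:Z - 2 * e%:Z) * slope_mid v k.
Proof.
have k0 := mid_k_gt0; have kS := triS k; move=> lo ev hi.
by rewrite (diff_block v k k) ?diff_poly_mid //; lia.
Qed.

Lemma mid_slope_gt0 : ('C(k, 2) + 'C(k.+1, 2) < 'C(v, 2))%N ->
  0 < slope_mid v k.
Proof.
move: mid => /andP[lo hi] N_gt; apply: slope_mid_gt0 => //.
by have := triS k; have := tri2 k; rewrite -mulnn; lia.
Qed.

Lemma diff_last_tri : ('C(k, 2) + 'C(k.+1, 2) <= 'C(v, 2))%N ->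
  let x := ('C(v, 2))%:Z - 2 * ('C(k, 2))%:Z in
  diff v 'C(k, 2) = (x - v%:Z) * (x - v%:Z + 1).
Proof.
have k0 := mid_k_gt0; have kS := triS k; have kSS := triS k.+1.
by move=> N_ge x; rewrite (diff_block v k k.+1) ?diff_poly_tri1 //; lia.
Qed.

(** By minimality the formula of block k + 1 always bounds D(e_0) from above; this yields D(e_0) <=
    0 under the Pell condition. *)
Lemma diff_last_tri_le :
  let x := ('C(v, 2))%:Z - 2 * ('C(k, 2))%:Z in
  diff v 'C(k, 2) <= (x - v%:Z) * (x - v%:Z + 1).
Proof.
have k0 := mid_k_gt0; have kS := triS k.
by rewrite /= -diff_poly_tri1; apply: diff_le_poly; lia.
Qed.

Lemma consecutive_mul_ge0 (x : int) : 0 <= x * (x + 1).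
Proof. nia. Qed.

Lemma diff_mid_gt0 e : 0 < slope_mid v k -> ('C(k, 2) < e)%N ->
  (2 * e < 'C(v, 2))%N -> 0 < diff v e.
Proof.
have k0 := mid_k_gt0; have kS := triS k; move=> s0 lo ev.
have [e_hi|e_lo] := leqP 'C(v, 2) (e + 'C(k.+1, 2)).
  have := diff_mid e (ltnW lo) (ltnW ev) e_hi.
  have : 0 < (('C(v, 2))%:Z - 2 * e%:Z) * slope_mid v k.
    by apply: mulr_gt0; lia.
  by lia.
(* At e2 the count N - e enters block k, so the segment formula gives D(e2) > 0; concavity from
   'C(k, 2), where D >= 0, covers e. *)
set e2 := ('C(v, 2) - 'C(k.+1, 2))%N.
have e2E : e2 = ('C(v, 2) - 'C(k.+1, 2))%N by [].
have D2 : 0 < diff v e2.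
  have := diff_mid e2; have : 0 < (('C(v, 2))%:Z - 2 * e2%:Z) * slope_mid v k.
    by apply: mulr_gt0; lia.
  by move=> pos /(_ ltac:(lia) ltac:(lia) ltac:(lia)); lia.
have D1 : 0 <= diff v 'C(k, 2).
  by rewrite diff_last_tri ?consecutive_mul_ge0 //; lia.
have Dconc := diff_concave v k 'C(k, 2) e e2 k0 (leqnn _)
  ltac:(lia) ltac:(lia) ltac:(lia).
suff : 0 < (e2%:Z - 'C(k, 2)%:Z) * diff v e by rewrite pmulr_rgt0 //; lia.
apply: lt_le_trans Dconc; apply: ltr_wpDl; first by apply: mulr_ge0; lia.
by apply: mulr_gt0; lia.
Qed.

Lemma diff_last_tri_ge0 : 0 <= slope_mid v k -> 0 <= diff v 'C(k, 2).
Proof.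
move=> s0; have [N_le|N_gt] := leqP 'C(v, 2) ('C(k, 2) + 'C(k.+1, 2)).
  have := diff_mid 'C(k, 2) (leqnn _) ltac:(lia) N_le.
  have : 0 <= (('C(v, 2))%:Z - 2 * ('C(k, 2))%:Z) * slope_mid v k.
    by apply: mulr_ge0; lia.
  by lia.
by rewrite diff_last_tri ?consecutive_mul_ge0 //; lia.
Qed.

Lemma diff_gt0_last e : 0 <= slope_mid v k -> (3 < e < 'C(k, 2))%N ->
  0 < diff v e.
Proof.
move=> s0 e_bounds; have D0 := diff_last_tri_ge0 s0.
have [k5|k4] := leqP 5 k; first by apply: (diff_gt0_below v k); lia.
(* For k = 4 only v = 6 remains, with slope zero and D = 0 at both ends of block 3; e = 4 and e = 5
   are computed. *)
have k_eq : k = 4%N.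
  have : (4 <= k)%N.
    rewrite leqNgt; apply/negP => k3; have := @leq_bin2l k 3 2 k3.
    by rewrite (_ : 'C(3, 2) = 3)%N //; lia.
  by lia.
have C4 : 'C(4, 2) = 6%N by [].
have C5 : 'C(5, 2) = 10%N by [].
have v_eq : v = 6%N.
  move: mid s0 (tri2 v); rewrite /slope_mid k_eq C4 C5; nia.
have C6 : 'C(6, 2) = 15%N by [].
move: e_bounds; rewrite v_eq k_eq C4 => e_bounds.
have C3 : 'C(3, 2) = 3%N by [].
rewrite (diff_block 6 3 5) ?C3 ?C4 ?C5 ?C6; try lia.
by rewrite /diff_poly /qc_poly C3 C5 C6; nia.
Qed.

Lemma diff_half e : (2 * e = 'C(v, 2))%N -> diff v e = 0.
Proof.
move=> ev; have := diff_sub v e ltac:(lia).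
by rewrite (_ : ('C(v, 2) - e)%N = e); lia.
Qed.

Lemma diff_lower_half_pos e : 0 < slope_mid v k -> (2 * e <= 'C(v, 2))%N ->
  let x := ('C(v, 2))%:Z - 2 * ('C(k, 2))%:Z in
  0 <= diff v e /\
  (diff v e = 0 <-> (e <= 3)%N \/ (2 * e = 'C(v, 2))%N \/
                    e = 'C(k, 2) /\ (x = v%:Z \/ x = v%:Z - 1)).
Proof.
move=> s0 ev x; have [e3|e3] := leqP e 3.
  by rewrite diff_le3 //; split=> //; split=> _; [left|].
have [e_half|e_half] := eqVneq (2 * e)%N 'C(v, 2).
  by rewrite diff_half //; split=> //; split=> _; [right; left|].
have {}ev : (2 * e < 'C(v, 2))%N by rewrite ltn_neqAle e_half.
have e_half' : (2 * e)%N <> 'C(v, 2) by apply/eqP.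
case: (ltngtP e 'C(k, 2)) => [lo|hi|eE].
- have D0 : 0 < diff v e by apply: diff_gt0_last; lia.
  by split; [exact: ltW | split=> [D_eq0|]; [rewrite D_eq0 in D0 | lia]].
- have D0 : 0 < diff v e by apply: diff_mid_gt0.
  by split; [exact: ltW | split=> [D_eq0|]; [rewrite D_eq0 in D0 | lia]].
rewrite eE; have D_ge0 := diff_last_tri_ge0 (ltW s0).
split=> //; split=> [D_eq0|].
  right; right; split=> //.
  have [N_le|N_gt] := leqP 'C(v, 2) ('C(k, 2) + 'C(k.+1, 2)).
    have := diff_mid 'C(k, 2) (leqnn _) ltac:(lia) N_le; rewrite D_eq0.
    have : 0 < (('C(v, 2))%:Z - 2 * ('C(k, 2))%:Z) * slope_mid v k.
      by apply: mulr_gt0; lia.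
    by lia.
  move/eqP: D_eq0; rewrite diff_last_tri; last by lia.
  by rewrite mulf_eq0 -/x => /orP[] /eqP ?; [left | right]; lia.
move=> tri_eq; apply/le_anti; rewrite D_ge0 andbT.
apply: le_trans diff_last_tri_le _; rewrite -/x.
by case: tri_eq => [|[|[_ [->|->]]]]; [lia | lia | rewrite subrr mul0r | nia].
Qed.

Lemma diff_lower_half_zero e : slope_mid v k = 0 -> (2 * e <= 'C(v, 2))%N ->
  0 <= diff v e /\ (diff v e = 0 <-> (e <= 3)%N \/ ('C(k, 2) <= e)%N).
Proof.
move=> s0 ev; have [e3|e3] := leqP e 3.
  by rewrite diff_le3 //; split=> //; split=> _; [left|].
have [lo|lo] := leqP 'C(k, 2) e.
  have := diff_mid e lo ev; rewrite s0 mulr0.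
  have [e_hi|e_hi] := leqP 'C(v, 2) (e + 'C(k.+1, 2)); last first.
    by have := mid_slope_gt0 ltac:(lia); rewrite s0.
  move=> /(_ isT) D_eq0; have -> : diff v e = 0 by lia.
  by split=> //; split=> _; [right|].
have := diff_gt0_last e; rewrite s0 => /(_ (lexx _) ltac:(lia)) D0.
by split; [exact: ltW | split=> [D_eq0|]; [rewrite D_eq0 in D0 | lia]].
Qed.
(** The line is (N - 2e) [slope_mid] - 4 (k - 2) (e - 'C(k, 2)), a negative term minus a nonnegative
    one: its sign change occurs below e_0. *)
Lemma low_line_lt0 e : slope_mid v k < 0 -> ('C(k, 2) <= e)%N ->
  (2 * e < 'C(v, 2))%N -> low_line v k e%:Z < 0.
Proof.
move=> s0 lo ev; have k0 := mid_k_gt0.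
have k2 : (2 <= k)%N.
  rewrite ltnNge; apply/negP => k1; have k_eq : k = 1%N by lia.
  by move: s0; rewrite /slope_mid k_eq; case: (leqP v 2); nia.
have : 0 <= (e%:Z - ('C(k, 2))%:Z) * (k%:Z - 2) by apply: mulr_ge0; lia.
have : (('C(v, 2))%:Z - 2 * e%:Z) * slope_mid v k < 0.
  by rewrite pmulr_rlt0 //; lia.
by rewrite /low_line /slope_low; lia.
Qed.

(** From 'C(k, 2) on, D has the sign of [slope_mid]; on the low segment 2D is the line; further left
    the line is positive, and so is D for e > 3, by concavity. *)
Lemma diff_lower_half_neg e : (5 <= v)%N -> slope_mid v k < 0 ->
  (2 * e <= 'C(v, 2))%N ->
  [/\ 0 <= low_line v k e%:Z -> 0 <= diff v e,
      low_line v k e%:Z <= 0 -> diff v e <= 0 &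
      diff v e = 0 <-> (e <= 3)%N \/ low_line v k e%:Z = 0 \/
                       (2 * e = 'C(v, 2))%N].
Proof.
move=> v5 s0 ev; have [low_gt0 end_gt0] := low_facts v k v5 mid s0.
have k0 := mid_k_gt0; have kS := triS k.
have N_le : ('C(v, 2) <= 'C(k, 2) + 'C(k.+1, 2))%N.
  by rewrite leqNgt; apply/negP => /mid_slope_gt0; rewrite ltNge (ltW s0).
have {}end_gt0 : 0 < low_line v k (('C(v, 2))%:Z - ('C(k.+1, 2))%:Z).
  by apply: end_gt0; have := tri2 k; rewrite -mulnn; lia.
(* Smaller k leave only v = 5 and v = 6, whose slopes are not negative. Thus h = k - 1 >= 4 below,
   as [diff_tri_gt0] requires. *)
have k5 : (5 <= k)%N.
  rewrite leqNgt; apply/negP => k_lt5.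
  have v7 : (v <= 6)%N by move: mid (tri2 v) (tri2 k); rewrite kS; nia.
  have v56 : v = 5%N \/ v = 6%N by lia.
  have k34 : k = 3%N \/ k = 4%N.
    move: mid (tri2 v) (tri2 k); rewrite kS; case: v56 => ->; nia.
  have := tri2 k; have := tri2 v; move: s0 mid; rewrite kS /slope_mid.
  by case: v56 => ->; case: k34 => ->; lia.
have low_mono (a b : int) : a < b -> low_line v k b < low_line v k a.
  move=> ab; rewrite -subr_gt0.
  have -> : low_line v k a - low_line v k b = 2 * (slope_low v k * (b - a)).
    by rewrite /low_line; ring.
  by rewrite !mulr_gt0 // subr_gt0.
have [h kE] : exists h, k = h.+1 by exists k.-1; lia.
have hS := triS h; rewrite -kE in hS.
have diff_low a : ('C(h, 2) <= a <= 'C(k, 2))%N ->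
    ('C(v, 2) <= a + 'C(k.+1, 2))%N -> 2 * diff v a = low_line v k a%:Z.
  move=> /andP[lo hi] N_a; rewrite [in RHS]kE -diff_poly_low -kE.
  by rewrite (diff_block v h k) //; rewrite -?kE; lia.
have Nh : (2 * 'C(h.+1, 2) <= 'C(v, 2))%N by rewrite -kE; lia.
have Dh : 0 < diff v 'C(h, 2) by apply: diff_tri_gt0 => //; lia.
have [e_half|e_half] := eqVneq (2 * e)%N 'C(v, 2).
  by rewrite diff_half //; split=> //; split=> // _; right; right.
have {}ev : (2 * e < 'C(v, 2))%N by rewrite ltn_neqAle e_half.
have e_half' : (2 * e)%N <> 'C(v, 2) by apply/eqP.
have [hi|lo] := leqP 'C(k, 2) e.
  have low_lt0 := low_line_lt0 e s0 hi ev.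
  have D2 := diff_mid e hi (ltnW ev) ltac:(lia).
  have : (('C(v, 2))%:Z - 2 * e%:Z) * slope_mid v k < 0.
    by rewrite pmulr_rlt0 //; lia.
  move=> D_lt0; have e4 : (3 < e)%N.
    by have := @leq_bin2l 5 k 2 k5; rewrite (_ : 'C(5, 2) = 10)%N //; lia.
  by split; [lia.. | split; lia].
have [|/andP inner] := boolP (('C(h, 2) <= e)
    && ('C(v, 2) <= e + 'C(k.+1, 2)))%N.
  move=> /andP[e_h e_N]; have D2 := diff_low e ltac:(lia) e_N.
  have e4 : (3 < e)%N.
    have := @leq_bin2l 4 h 2 ltac:(lia).
    by rewrite (_ : 'C(4, 2) = 6)%N //; lia.
  by split; [lia.. | split; lia].
(* The low segment starts at the larger of 'C(h, 2) and N - 'C(k+1, 2); the decreasing line is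
   positive there. *)
have line_gt0 : 0 < low_line v k e%:Z.
  have [e_N|e_N] := leqP 'C(v, 2) (e + 'C(k.+1, 2)).
    apply: lt_trans (low_mono e%:Z ('C(h, 2))%:Z _); last by lia.
    by rewrite -diff_low; lia.
  by apply: lt_trans end_gt0 (low_mono _ _ _); lia.
have [e3|e3] := leqP e 3.
  by rewrite diff_le3 //; [split=> //; split=> // _; left | lia].
suff D_gt0 : 0 < diff v e.
  by split; [move=> _; exact: ltW | lia | split; lia].
have [e_h|e_h] := leqP 'C(h, 2) e; last first.
  by apply: (diff_gt0_below v h) => //; [lia | lia | exact: ltW | right].
have e_N : (e + 'C(k.+1, 2) < 'C(v, 2))%N by rewrite ltnNge; apply/negP; lia.
set e2 := ('C(v, 2) - 'C(k.+1, 2))%N.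
have e2E : e2 = ('C(v, 2) - 'C(k.+1, 2))%N by [].
have D2 : 0 < diff v e2.
  have := diff_low e2 ltac:(lia) ltac:(lia).
  by rewrite (_ : e2%:Z = ('C(v, 2))%:Z - ('C(k.+1, 2))%:Z); lia.
apply: (diff_gt0_block v h e e2) => //; try lia.
by rewrite -kE; lia.
Qed.
End Middle.

(** * Translation to rational thresholds *)

Lemma le_mE v e : (e%:R <= m v) = (2 * e <= 'C(v, 2))%N.
Proof. by rewrite /m ler_pdivlMr // -[2]/(2%:R) -natrM ler_nat mulnC. Qed.

Lemma ge_mE v e : (m v <= e%:R) = ('C(v, 2) <= 2 * e)%N.
Proof. by rewrite /m ler_pdivrMr // -[2]/(2%:R) -natrM ler_nat mulnC. Qed.

Lemma eq_mE v e : (e%:R == m v) = (2 * e == 'C(v, 2))%N.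
Proof. by rewrite eq_le le_mE ge_mE -eqn_leq. Qed.

Lemma q0E v k : q0 v k = (slope_mid v k)%:~R.
Proof. by rewrite /q0 /slope_mid; field. Qed.

Lemma mem_small_or_half v e :
  (e%:R \in [:: 0; 1; 2; 3; m v]) = (e <= 3)%N || (2 * e == 'C(v, 2))%N.
Proof.
rewrite !inE eq_mE !orbA; congr (_ || _).
rewrite -[0]/(0%:R) -[1]/(1%:R) -[2]/(2%:R) -[3]/(3%:R) !eqr_nat; lia.
Qed.

(** The denominator of R_0 is four times [slope_low]; comparing e with m - R_0 thus amounts to
    reading the sign of the line. *)
Lemma subR0_low_line v k e : 0 < slope_low v k ->
  2 * (slope_low v k)%:~R * (m v - R0 v k - e%:R) = (low_line v k e%:Z)%:~R.
Proof.
move=> s0; have sr : 0 < (slope_low v k)%:~R :> rat by rewrite ltr0z.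
have denE : -1 - 2 * (2 * k%:R - 4) ^+ 2 + (2 * v%:R - 5) ^+ 2 =
    4 * (slope_low v k)%:~R :> rat by rewrite /slope_low /slope_mid; ring.
rewrite /R0 denE /low_line /m /e0.
by field; rewrite gt_eqF.
Qed.

Lemma le_subR0E v k e : 0 < slope_low v k ->
  (e%:R <= m v - R0 v k) = (0 <= low_line v k e%:Z).
Proof.
move=> s0; have sr : 0 < 2 * (slope_low v k)%:~R :> rat.
  by rewrite mulr_gt0 // ltr0z.
by rewrite -(ler0z rat) -subR0_low_line // pmulr_rge0 // subr_ge0.
Qed.

Lemma ge_subR0E v k e : 0 < slope_low v k ->
  (m v - R0 v k <= e%:R) = (low_line v k e%:Z <= 0).
Proof.
move=> s0; have sr : 0 < 2 * (slope_low v k)%:~R :> rat.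
  by rewrite mulr_gt0 // ltr0z.
by rewrite -(lerz0 rat) -subR0_low_line // pmulr_rle0 // subr_le0.
Qed.

Lemma eq_subR0E v k e : 0 < slope_low v k ->
  (e%:R == m v - R0 v k) = (low_line v k e%:Z == 0).
Proof. by move=> s0; rewrite !eq_le le_subR0E // ge_subR0E // andbC. Qed.

Lemma m_sub v e : (e <= 'C(v, 2))%N -> m v - ('C(v, 2) - e)%:R = e%:R - m v.
Proof. by move=> ev; rewrite natrB // /m; field. Qed.

(** The reflection of e to N - e moves the threshold m + R_0 to m - R_0. *)
Lemma le_addR0E v k e : (e <= 'C(v, 2))%N ->
  (e%:R <= m v + R0 v k) = (m v - R0 v k <= ('C(v, 2) - e)%:R).
Proof. by move=> ev; rewrite -lerBlDl -m_sub // lerBlDl lerBlDr. Qed.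

Lemma ge_addR0E v k e : (e <= 'C(v, 2))%N ->
  (m v + R0 v k <= e%:R) = (('C(v, 2) - e)%:R <= m v - R0 v k).
Proof. by move=> ev; rewrite -lerBrDl -m_sub // lerBrDr lerBrDl. Qed.

Lemma Cval_le_Sval v e : (0 < v)%N -> (e <= 'C(v, 2))%N ->
  (Cval v e <= Sval v e)%N = (0 <= diff v e).
Proof. by move=> v0 ev; rewrite -diff_Sval_Cval //; lia. Qed.

Lemma Sval_le_Cval v e : (0 < v)%N -> (e <= 'C(v, 2))%N ->
  (Sval v e <= Cval v e)%N = (diff v e <= 0).
Proof. by move=> v0 ev; rewrite -diff_Sval_Cval //; lia. Qed.

Lemma Sval_eq_Cval v e : (0 < v)%N -> (e <= 'C(v, 2))%N ->
  (Sval v e = Cval v e) <-> (diff v e = 0).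
Proof. by move=> v0 ev; rewrite -diff_Sval_Cval //; lia. Qed.

(** This excludes e = m - R_0 above m, where the lower-half analysis says nothing. *)
Lemma low_line_upper v k e : (2 <= k)%N -> (2 * 'C(k, 2) <= 'C(v, 2))%N ->
  0 < slope_low v k -> ('C(v, 2) < 2 * e)%N -> low_line v k e%:Z < 0.
Proof.
move=> k2 Nk s0 ev; rewrite /low_line.
have : 0 < slope_low v k * (2 * e%:Z - ('C(v, 2))%:Z).
  by rewrite mulr_gt0 //; lia.
have : 0 <= (('C(v, 2))%:Z - 2 * ('C(k, 2))%:Z) * (k%:Z - 2).
  by apply: mulr_ge0; lia.
by lia.
Qed.

Theorem theorem6 (v k0 : nat) (hv : (0 < v)%N)
    (hk0 : 'C(k0, 2)%:R <= m v < 'C(k0.+1, 2)%:R) :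
  [/\ (0 < q0 v k0 ->
        forall e e' : nat, (e <= 'C(v, 2))%N -> e' = ('C(v, 2) - e)%N ->
        [/\ (e%:R <= m v -> (Cval v e <= Sval v e)%N),
            (m v <= e%:R -> (Sval v e <= Cval v e)%N) &
            (Sval v e = Cval v e <->
               (e%:R \in [:: 0; 1; 2; 3; m v]) \/
               (e'%:R \in [:: 0; 1; 2; 3; m v]) \/
               ((e = e0 k0 \/ e' = e0 k0) /\
                (2 * v%:Z - 3) ^+ 2 - 2 * (2 * k0%:Z - 1) ^+ 2
                  \in [:: -1; 7]))]),
      (q0 v k0 < 0 ->
        forall e e' : nat, (e <= 'C(v, 2))%N -> e' = ('C(v, 2) - e)%N ->
        [/\ (e%:R <= m v - R0 v k0 -> (Cval v e <= Sval v e)%N),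
            (m v - R0 v k0 <= e%:R <= m v -> (Sval v e <= Cval v e)%N),
            (m v <= e%:R <= m v + R0 v k0 -> (Cval v e <= Sval v e)%N),
            (m v + R0 v k0 <= e%:R -> (Sval v e <= Cval v e)%N) &
            (Sval v e = Cval v e <->
               (e%:R \in [:: 0; 1; 2; 3; m v - R0 v k0; m v]) \/
               (e'%:R \in [:: 0; 1; 2; 3; m v - R0 v k0; m v]))]) &
      (q0 v k0 = 0 ->
        forall e e' : nat, (e <= 'C(v, 2))%N -> e' = ('C(v, 2) - e)%N ->
        [/\ (e%:R <= m v -> (Cval v e <= Sval v e)%N),
            (m v <= e%:R -> (Sval v e <= Cval v e)%N) &
            (Sval v e = Cval v e <->
               (e \in [:: 0; 1; 2; 3]%N) \/ (e' \in [:: 0; 1; 2; 3]%N) \/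
               ((e0 k0 <= e)%N /\ e%:R <= m v) \/
               ((e0 k0 <= e')%N /\ e'%:R <= m v))])].
Proof.
have mid : (2 * 'C(k0, 2) <= 'C(v, 2) < 2 * 'C(k0.+1, 2))%N.
  by move: hk0; rewrite le_mE ltNge le_mE -ltnNge.
rewrite !q0E /e0; split=> s0 e e' ev e'E.
- have D_e : diff v e' = - diff v e by rewrite e'E diff_sub.
  have SC := Sval_eq_Cval v e hv ev.
  rewrite Cval_le_Sval // Sval_le_Cval // !mem_small_or_half.
  rewrite le_mE ge_mE; move: s0; rewrite ltr0z => s0.
  set x := ('C(v, 2))%:Z - 2 * ('C(k0, 2))%:Z.
  (* The Pell quantity is 8 (x - v) + 7, so 7 means x = v and -1 means x = v - 1. *)
  have -> : ((2 * v%:Z - 3) ^+ 2 - 2 * (2 * k0%:Z - 1) ^+ 2 \in [:: -1; 7]) =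
      (x == v%:Z) || (x == v%:Z - 1).
    by rewrite !inE /x; have := tri2 v; have := tri2 k0; lia.
  have [e_low|e_up] := leqP (2 * e) 'C(v, 2).
    have [D_ge0 D_eq0] := diff_lower_half_pos v k0 hv mid e s0 e_low.
    by split; [lia | lia | lia].
  have e'_low : (2 * e' <= 'C(v, 2))%N by lia.
  have [D_ge0 D_eq0] := diff_lower_half_pos v k0 hv mid e' s0 e'_low.
  by split; [lia | lia | lia].
- have D_e : diff v e' = - diff v e by rewrite e'E diff_sub.
  have SC := Sval_eq_Cval v e hv ev.
  have e'v : (e' <= 'C(v, 2))%N by lia.
  move: s0; rewrite ltrz0 => s0; rewrite Cval_le_Sval // Sval_le_Cval //.
  have half_cmp : (m v <= e%:R) = (e'%:R <= m v) by rewrite ge_mE le_mE; lia.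
  (* Below 5, a negative q_0 leaves only v = 4 with N = 6; then e or e' is at most 3 and D is
     identically zero. *)
  have [v4|v5] := leqP v 4.
    have k3 : (k0 <= 3)%N by move: mid (tri2 v) (tri2 k0); nia.
    have v_eq : v = 4%N.
      have v_cases : (v = 1 \/ v = 2 \/ v = 3 \/ v = 4)%N by lia.
      have k_cases : (k0 = 0 \/ k0 = 1 \/ k0 = 2 \/ k0 = 3)%N by lia.
      move: s0 mid (tri2 v) (tri2 k0); rewrite triS /slope_mid.
      by case: v_cases => [|[|[]]] ->; case: k_cases => [|[|[]]] ->; lia.
    have N_eq : 'C(v, 2) = 6%N by rewrite v_eq.
    have small a : (a <= 3)%N ->
        a%:R \in [:: 0; 1; 2; 3; m v - R0 v k0; m v].
      move=> a3; have : a%:R \in [:: 0; 1; 2; 3; m v].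
        by rewrite mem_small_or_half a3.
      by rewrite !inE => /or4P[->|->|->|/orP[]->]; rewrite ?orbT.
    have [e3|e4] := leqP e 3.
      have D0 : diff v e = 0 by rewrite diff_le3 //; lia.
      by rewrite D0; split=> //; split=> _; [left; exact: small | exact/SC].
    have D0 : diff v e = 0.
      by have := diff_le3 v e' hv ltac:(lia) ltac:(lia); lia.
    have e'3 : (e' <= 3)%N by lia.
    by rewrite D0; split=> //; split=> _; [right; exact: small | exact/SC].
  have [low_gt0 _] := low_facts v k0 v5 mid s0.
  have k2 : (2 <= k0)%N.
    by move: mid (tri2 v) (tri2 k0); rewrite triS; nia.
  rewrite le_subR0E // ge_subR0E // half_cmp.
  rewrite le_addR0E // ge_addR0E // -e'E.
  rewrite le_subR0E // ge_subR0E // !le_mE.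
  have mem_list a : (a%:R \in [:: 0; 1; 2; 3; m v - R0 v k0; m v]) =
      (a%:R \in [:: 0; 1; 2; 3; m v]) || (low_line v k0 a%:Z == 0).
    by rewrite -eq_subR0E // !inE; do !case: (_ == _).
  rewrite !mem_list !mem_small_or_half.
  have upper a := low_line_upper v k0 a k2 ltac:(lia) low_gt0.
  have up_e := upper e; have up_e' := upper e'.
  have [e_low|e_up] := leqP (2 * e) 'C(v, 2).
    have [D_ge D_le D_eq0] :=
      diff_lower_half_neg v k0 hv mid e v5 s0 e_low.
    have [e'_low|e'_up] := leqP (2 * e') 'C(v, 2).
      have e'_eq : e' = e by lia.
      by rewrite e'_eq in D_e *; split; lia.
    by split; lia.
  have e'_low : (2 * e' <= 'C(v, 2))%N by lia.
  have [D_ge' D_le' D_eq0'] :=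
    diff_lower_half_neg v k0 hv mid e' v5 s0 e'_low.
  by split; lia.
have D_e : diff v e' = - diff v e by rewrite e'E diff_sub.
  have SC := Sval_eq_Cval v e hv ev.
move: s0 => /eqP; rewrite intr_eq0 => /eqP s0.
rewrite Cval_le_Sval // Sval_le_Cval // !inE !le_mE ge_mE.
have [e_low|e_up] := leqP (2 * e) 'C(v, 2).
  have [D_ge0 D_eq0] := diff_lower_half_zero v k0 hv mid e s0 e_low.
  by split; [lia | lia | lia].
have e'_low : (2 * e' <= 'C(v, 2))%N by lia.
have [D_ge0 D_eq0] := diff_lower_half_zero v k0 hv mid e' s0 e'_low.
by split; [lia | lia | lia].
Qed.
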